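(* Let $\Gamma=(G,\sigma)$ be a balanced signed graph on the vertex set $[n]=\{1,\dots,n\}$. Given integers $1\le k_1<k_2<n$, let $F_{k_1}(\Gamma)$ and $F_{k_2}(\Gamma)$ be its $k_1$-token and $k_2$-token signed graphs, with Laplacian matrices $L_{k_1}$ and $L_{k_2}$ respectively. Then there exists a signed binomial matrix $B$, that is, a real $\binom{n}{k_2}\times\binom{n}{k_1}$ matrix with rows indexed by the $k_2$-subsets $A$ of $[n]$, columns indexed by the $k_1$-subsets $X$ of $[n]$, and entries $B_{AX}\in\{+1,-1\}$ if $X\subset A$ and $B_{AX}=0$ otherwise, such that $$B\,L_{k_1}=L_{k_2}\,B.$$
   Context: All graphs are finite and simple. A signed graph $\Gamma=(G,\sigma)$ is a graph $G=(V,E)$ with a signature $\sigma:E\to\{+1,-1\}$. It is balanced if every cycle of $G$ has positive sign, the sign of a cycle being the product of the signs of its edges. The (signed) adjacency matrix $A$ of $\Gamma$ has entries $a_{uv}=\sigma(uv)$ if $uv\in E$ and $0$ otherwise; the Laplacian matrix is $L=D-A$, where $D$ is the diagonal matrix of vertex degrees in $G$. The $k$-token signed graph $F_k(\Gamma)$ has as vertices the $k$-element subsets of $V$; two vertices $A,B$ are adjacent iff $A\,\Delta\, B=\{a,b\}$ with $a\in A$, $b\in B$, $ab\in E$, and the edge $AB$ then has sign $\sigma(ab)$. *)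

(* Defs.v *)
From mathcomp Require Import all_boot all_order all_algebra.

Set Implicit Arguments.
Unset Strict Implicit.
Unset Printing Implicit Defensive.

Import GRing.Theory Num.Theory.

Local Open Scope ring_scope.

(* The signature is a total function on ordered pairs, but only its values on
   adjacent pairs are constrained or matter. *)
Record sgraph (V : finType) := SGraph {
  sg_adj : rel V;
  sg_sign : V -> V -> int;
  sg_adj_sym : symmetric sg_adj;
  sg_adj_irr : irreflexive sg_adj;
  sg_sign_sym : forall u v, sg_adj u v -> sg_sign u v = sg_sign v u;
  sg_sign_pm1 : forall u v, sg_adj u v -> sg_sign u v = 1 \/ sg_sign u v = -1
}.

(* A cycle is listed by its distinct vertices in order, at least three of them;
   [next c u] is the cyclic successor of [u], so that each edge of the cycle is
   counted once in [cycle_sign]. *)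
Definition is_cycle (V : finType) (G : sgraph V) (c : seq V) : bool :=
  [&& (2 < size c)%N, uniq c & cycle (sg_adj G) c].

Definition cycle_sign (V : finType) (G : sgraph V) (c : seq V) : int :=
  \prod_(u <- c) sg_sign G u (next c u).

Definition balanced (V : finType) (G : sgraph V) : Prop :=
  forall c : seq V, is_cycle G c -> cycle_sign G c = 1.

Definition degree (V : finType) (G : sgraph V) (u : V) : nat :=
  #|[set v | sg_adj G u v]|.

(* Rows and columns are indexed by the vertices through [enum_val]. *)
Definition adjacency_mx (R : pzRingType) (V : finType) (G : sgraph V) :
    'M[R]_#|V| :=
  \matrix_(i, j) if sg_adj G (enum_val i) (enum_val j)
                 then (sg_sign G (enum_val i) (enum_val j))%:~R else 0.

Definition degree_mx (R : pzRingType) (V : finType) (G : sgraph V) :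
    'M[R]_#|V| :=
  diag_mx (\row_i (degree G (enum_val i))%:R).

Definition laplacian_mx (R : pzRingType) (V : finType) (G : sgraph V) :
    'M[R]_#|V| :=
  degree_mx R G - adjacency_mx R G.

Definition ksubset (V : finType) (k : nat) := {A : {set V} | #|A| == k}.

Lemma card_ksubset (V : finType) (k : nat) : #|{: ksubset V k}| = 'C(#|V|, k).
Proof. by rewrite card_sig -card_draws cardsE. Qed.

Section TokenGraph.

Variables (V : finType) (G : sgraph V) (k : nat).

Implicit Types A B : ksubset V k.

Definition symdiff (A B : {set V}) : {set V} := (A :\: B) :|: (B :\: A).

Definition token_move A B (p : V * V) : bool :=
  [&& symdiff (val A) (val B) == [set p.1; p.2],
      p.1 \in val A, p.2 \in val B & sg_adj G p.1 p.2].

Definition token_adj A B : bool := [exists p, token_move A B p].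

(* The choice of [p] is immaterial, see [token_move_uniq] and [token_signE]; the
   value 1 is a junk value for nonadjacent [A] and [B]. *)
Definition token_sign A B : int :=
  if [pick p | token_move A B p] is Some p then sg_sign G p.1 p.2 else 1.

Lemma token_move_sym A B a b : token_move A B (a, b) = token_move B A (b, a).
Proof.
rewrite /token_move /= /symdiff setUC [[set b; a]]setUC sg_adj_sym.
by congr andb; rewrite andbCA.
Qed.

Lemma token_moveD A B p : token_move A B p ->
  val A :\: val B = [set p.1] /\ val B :\: val A = [set p.2].
Proof.
case: p => a b /and4P[/eqP/= eqD aA bB ab].
have ab_neq : a != b by apply: contraTneq ab => ->; rewrite sg_adj_irr.
have inD x : ((x \notin val B) && (x \in val A)) ||
    ((x \notin val A) && (x \in val B)) = (x == a) || (x == b).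
  by move/setP/(_ x): eqD; rewrite !inE.
have aB : a \notin val B by have := inD a; rewrite eqxx aA; case: (a \in _).
have bA : b \notin val A.
  by have := inD b; rewrite eqxx orbT bB; case: (b \in _).
split; apply/setP=> x; rewrite !inE.
- have [->|xa] := eqVneq x a; first by rewrite aB aA.
  have [->|xb] := eqVneq x b; first by rewrite bB.
  by have := inD x; rewrite (negPf xa) (negPf xb); case: (_ && _).
- have [->|xb] := eqVneq x b; first by rewrite bA bB.
  have [->|xa] := eqVneq x a; first by rewrite aA.
  by have := inD x; rewrite (negPf xa) (negPf xb); do 2!case: (_ \in _).
Qed.

Lemma token_move_uniq A B p q : token_move A B p -> token_move A B q -> p = q.
Proof.
move=> /token_moveD[pA pB] /token_moveD[]; rewrite pA pB.
move=> /set1_inj p1 /set1_inj p2.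
by case: p q p1 p2 {pA pB} => ? ? [? ?] /= -> ->.
Qed.

Lemma token_signE A B p :
  token_move A B p -> token_sign A B = sg_sign G p.1 p.2.
Proof.
move=> mp; rewrite /token_sign; case: pickP => [q mq|/(_ p)]; last by rewrite mp.
by rewrite (token_move_uniq mp mq).
Qed.

Lemma token_adj_sym : symmetric token_adj.
Proof.
by move=> A B; apply/existsP/existsP=> -[[a b] m]; exists (b, a);
  rewrite token_move_sym.
Qed.

Lemma token_adj_irr : irreflexive token_adj.
Proof.
move=> A; apply/existsP=> -[p /token_moveD[/setP/(_ p.1)]].
by rewrite !inE eqxx andNb.
Qed.

Lemma token_sign_sym A B : token_adj A B -> token_sign A B = token_sign B A.
Proof.
case/existsP=> -[a b] m; have m' := m; rewrite token_move_sym in m'.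
rewrite (token_signE m) (token_signE m') /=.
by case/and4P: m => _ _ _ /sg_sign_sym.
Qed.

Lemma token_sign_pm1 A B :
  token_adj A B -> token_sign A B = 1 \/ token_sign A B = -1.
Proof.
case/existsP=> p m; rewrite (token_signE m).
by case/and4P: m => _ _ _ /sg_sign_pm1.
Qed.

Definition token_graph : sgraph (ksubset V k) :=
  SGraph token_adj_sym token_adj_irr token_sign_sym token_sign_pm1.

End TokenGraph.

Definition signed_binomial (R : pzRingType) (V : finType) (k2 k1 : nat)
    (B : 'M[R]_(#|{: ksubset V k2}|, #|{: ksubset V k1}|)) : Prop :=
  forall (i : 'I_#|{: ksubset V k2}|) (j : 'I_#|{: ksubset V k1}|),
    if val (enum_val j) \subset val (enum_val i)
    then B i j = 1 \/ B i j = -1 else B i j = 0.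

(* Main.v *)
Require Import Defs.
From mathcomp Require Import all_boot all_order all_fingroup all_algebra ring.

(** Balance yields a switching function [s] with [sigma(uv) = s(u) s(v)]. With
    [S(A)] the product of [s] over [A], the token edge [AA'] has sign
    [S(A) S(A')], so both token Laplacians are switching equivalent to unsigned
    ones. The unsigned Laplacian is the sum over the edges [ab] of [1 - t_ab],
    where [t_ab] permutes the [k]-subsets by the transposition [(a b)], and
    inclusion of subsets is invariant under permutations of the vertices; hence
    [B A X = S(A) S(X) [X \subset A]] intertwines the Laplacians. *)

Set Implicit Arguments.
Unset Strict Implicit.
Unset Printing Implicit Defensive.

Import GRing.Theory Num.Theory.

Local Open Scope ring_scope.

(** * Walk signs and the switching function of a balanced graph *)

Section Switching.

Variables (V : finType) (G : sgraph V).

Implicit Types (x y z u v : V) (p q c : seq V).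

Fixpoint walk_sign x p : int :=
  if p is y :: p' then sg_sign G x y * walk_sign y p' else 1.

Lemma walk_sign_cat x p q :
  walk_sign x (p ++ q) = walk_sign x p * walk_sign (last x p) q.
Proof. by elim: p x => [|y p IHp] x /=; rewrite ?mul1r // IHp mulrA. Qed.

Lemma sg_sign_sqr u v : sg_adj G u v -> sg_sign G u v * sg_sign G u v = 1.
Proof. by case/sg_sign_pm1=> ->. Qed.

Lemma walk_sign_pm1 x p :
  path (sg_adj G) x p -> walk_sign x p = 1 \/ walk_sign x p = -1.
Proof.
elim: p x => [|y p IHp] x /=; first by left.
by case/andP=> /sg_sign_pm1[] -> /IHp[] ->; [left|right|right|left].
Qed.

(** Keeping the first vertex [y0] of the cycle apart from the head [y] lets the induction peel off
    vertices while the closing edge still returns to [y0]. *)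
Lemma prod_next_at y0 y c : uniq (y :: c) ->
  \prod_(u <- y :: c) sg_sign G u (next_at u y0 y c) = walk_sign y (rcons c y0).
Proof.
elim: c y => [|z c IHc] y; first by rewrite big_seq1 /= eqxx mulr1.
case/andP=> yc uc; rewrite big_cons [next_at y _ _ _]/= eqxx /=.
rewrite -(IHc z uc); congr (_ * _).
apply: eq_big_seq => u uzc /=.
by case: eqP uzc yc => // -> ->.
Qed.

Lemma cycle_sign_walk x c :
  uniq (x :: c) -> cycle_sign G (x :: c) = walk_sign x (rcons c x).
Proof. exact: prod_next_at. Qed.

Lemma not_uniq_split p : ~~ uniq p ->
  exists y p1 p2 p3, p = p1 ++ y :: p2 ++ y :: p3.
Proof.
elim: p => //= y p IHp; rewrite negb_and negbK => /orP[|/IHp].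
  by case/splitPr=> p2 p3; exists y, [::], p2, p3.
by move=> [z [p1 [p2 [p3 ->]]]]; exists z, (y :: p1), p2, p3.
Qed.

(* A closed walk that repeats a vertex splits there into two shorter ones; the
   others are empty, run twice along an edge, or are cycles. *)
Lemma closed_walk_sign x p : balanced G ->
  path (sg_adj G) x p -> last x p = x -> walk_sign x p = 1.
Proof.
move=> bG; have [n] := ubnP (size p); elim: n x p => // n IHn x p le_pn pp lp.
(* The initial [x] is not listed in [p], so its return at the end does not count as a repetition. *)
have [up|/not_uniq_split[y [p1 [p2 [p3 def_p]]]]] := boolP (uniq p); last first.
  move: le_pn pp lp; rewrite {p}def_p -cat_rcons -cat_rcons.
  rewrite !size_cat !size_rcons !cat_path !last_cat !last_rcons.
  rewrite !walk_sign_cat !last_rcons => le_pn /and3P[pp1 pp2 pp3] lp.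
  rewrite (IHn y (rcons p2 y)) ?last_rcons //; last first.
    rewrite -ltnS; apply: leq_trans le_pn.
    by rewrite size_rcons !addSn !addnS !ltnS addnCA leq_addr.
  have := IHn x (rcons p1 y ++ p3).
  rewrite walk_sign_cat !last_rcons mul1r => -> //.
  - rewrite -ltnS; apply: leq_trans le_pn.
    by rewrite size_cat size_rcons !addSn !addnS !ltnS leq_add2l leq_addl.
  - by rewrite cat_path pp1 last_rcons.
  - by rewrite last_cat last_rcons.
case/lastP: p le_pn pp lp up => // c z _ pp; rewrite last_rcons => zx up.
move: up pp; rewrite {z}zx rcons_uniq => uc pp.
have {}uc : uniq (x :: c) by [].
rewrite -cycle_sign_walk //.
case: c uc pp => [|y [|z c]] uc pp.
- by move: pp; rewrite /= sg_adj_irr.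
- rewrite cycle_sign_walk //= mulr1.
  case/and3P: pp => xy _ _.
  by rewrite -(sg_sign_sym xy) sg_sign_sqr.
- by apply: bG; rewrite /is_cycle uc.
Qed.

Definition walk_of_sign x y (e : int) : Prop :=
  exists p, [/\ path (sg_adj G) x p, last x p = y & walk_sign x p = e].

Lemma walk_of_sign_trans y x z e f :
  walk_of_sign x y e -> walk_of_sign y z f -> walk_of_sign x z (e * f).
Proof.
move=> [p [pp <- <-]] [q [qq <- <-]]; exists (p ++ q).
by rewrite cat_path pp qq last_cat walk_sign_cat.
Qed.

Lemma walk_of_sign_edge x y :
  sg_adj G x y -> walk_of_sign x y (sg_sign G x y).
Proof. by move=> xy; exists [:: y]; rewrite /= xy mulr1. Qed.

Lemma walk_of_sign_sym x y e : walk_of_sign x y e -> walk_of_sign y x e.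
Proof.
case=> p [pp <- <-] {y e}; elim: p x pp => [|y p IHp] x /=; first by exists [::].
case/andP=> xy /IHp wp; rewrite mulrC (sg_sign_sym xy).
by apply: walk_of_sign_trans wp _; apply: walk_of_sign_edge; rewrite sg_adj_sym.
Qed.

(** Take for [s u] the sign of some walk from [u] to the root of its component. An edge [uv] and the
    walks chosen for [u] and [v] form a closed walk, whose sign is 1 by balance. *)
Lemma balanced_switching : balanced G -> exists s : V -> int,
  (forall u, s u = 1 \/ s u = -1) /\
  (forall u v, sg_adj G u v -> sg_sign G u v = s u * s v).
Proof.
move=> bG; pose r := fingraph.root (sg_adj G).
have csym : connect_sym (sg_adj G) by apply: sym_connect_sym; apply: sg_adj_sym.
have /fin_all_exists[s sP] : forall u, exists e, walk_of_sign u (r u) e.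
  move=> u; have /connectP[p pp lp] := connect_root (sg_adj G) u.
  by exists (walk_sign u p), p.
have s_pm1 u : s u = 1 \/ s u = -1.
  by have [p [pp _ <-]] := sP u; apply: walk_sign_pm1.
exists s; split=> // u v uv.
have ruv : r u = r v by apply/(fingraph.rootP csym); apply: connect1.
have [p [pp lp ep]] : walk_of_sign u u (sg_sign G u v * s v * s u).
  apply: walk_of_sign_trans (walk_of_sign_sym (sP u)).
  by rewrite ruv; apply: walk_of_sign_trans (sP v); apply: walk_of_sign_edge.
have := closed_walk_sign bG pp lp; rewrite ep.
by case: (s_pm1 u) (s_pm1 v) (sg_sign_pm1 uv) => -> [] -> [] ->.
Qed.

End Switching.

(** * Transpositions of vertices acting on subsets *)

Section Transpositions.

Variable V : finType.

Implicit Types (A X : {set V}) (p : V * V).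

Definition tswap p A : {set V} := tperm p.1 p.2 @: A.

Lemma in_tswap p A x : (x \in tswap p A) = (tperm p.1 p.2 x \in A).
Proof. by rewrite -{1}(tpermK p.1 p.2 x) mem_imset //; apply: perm_inj. Qed.

Lemma tswapK p : involutive (tswap p).
Proof. by move=> A; apply/setP=> x; rewrite !in_tswap tpermK. Qed.

Lemma tswapC a b A : tswap (a, b) A = tswap (b, a) A.
Proof. by rewrite /tswap /= tpermC. Qed.

Lemma tswap_id a b A : (a \in A) = (b \in A) -> tswap (a, b) A = A.
Proof.
by move=> abA; apply/setP=> x; rewrite in_tswap /=; case: tpermP => // ->.
Qed.

(** An involution that preserves inclusion can be moved from one side to the other. This is what
    makes inclusion commute with the unsigned Laplacians. *)
Lemma tswap_subset p A X : (tswap p X \subset A) = (X \subset tswap p A).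
Proof.
by apply/idP/idP => /(imsetS (tperm p.1 p.2)); rewrite -!/(tswap p _) tswapK.
Qed.

Lemma card_tswap k p (A : ksubset V k) : #|tswap p (val A)| == k.
Proof. by rewrite card_imset ?(valP A) //; apply: perm_inj. Qed.

Definition kswap k p (A : ksubset V k) : ksubset V k :=
  exist _ (tswap p (val A)) (card_tswap p A).

Lemma kswapK k p : involutive (@kswap k p).
Proof. by move=> A; apply: val_inj; rewrite /= tswapK. Qed.

End Transpositions.

(** * Token adjacency and degree counted by transpositions *)

Section TokenLaplacian.

Variables (V : finType) (G : sgraph V) (k : nat).

Implicit Types A B : ksubset V k.

Lemma token_moveE A B a b : token_move G A B (a, b) =
  [&& a \in val A, b \notin val A, sg_adj G a b & kswap (a, b) A == B].
Proof.
apply/idP/and4P=> [mAB|[aA bA ab /eqP<-]].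
  have [/setP AB /setP BA] := token_moveD mAB.
  case/and4P: mAB => /= _ aA bB ab.
  have bA : b \in val A = false.
    by apply/negbTE; have := BA b; rewrite !inE eqxx bB andbT.
  have aB : a \in val B = false.
    by apply/negbTE; have := AB a; rewrite !inE eqxx aA andbT.
  split=> //; first by rewrite bA.
  (* The transposition exchanges [a] and [b]; any other vertex lies in neither difference, hence in
     both sets or in none. *)
  apply/eqP/val_inj/setP=> x /=; rewrite in_tswap /=.
  have := AB x; have := BA x; rewrite !inE.
  case: tpermP => [->|->|/eqP/negPf-> /eqP/negPf->]; rewrite ?bA ?aB ?aA ?bB //.
  by do 2!case: (_ \in _).
have ab_neq : a != b by apply: contraTneq ab => ->; rewrite sg_adj_irr.
rewrite /token_move /= in_tswap /= tpermR aA ab /= andbT.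
apply/eqP/setP=> x; rewrite !inE in_tswap /=.
case: tpermP => [->|->|/eqP/negPf-> /eqP/negPf->].
- by rewrite aA (negPf bA) eqxx.
- by rewrite aA (negPf bA) eqxx orbT.
- by case: (_ \in _).
Qed.

(** If [A] contains both or neither of [a] and [b], the swap fixes [A] and cannot reach [B].
    Otherwise membership selects exactly one orientation of the move. *)
Lemma kswap_move A B a b : A != B ->
  (sg_adj G a b && (kswap (a, b) A == B) : nat) =
  (token_move G A B (a, b) + token_move G A B (b, a))%N.
Proof.
move=> AB; rewrite !token_moveE (sg_adj_sym G b a).
have -> : kswap (b, a) A = kswap (a, b) A by apply: val_inj; apply: tswapC.
case aA: (a \in _); case bA: (b \in _); rewrite /= ?addn0 //.
all: have -> : kswap (a, b) A = A by apply: val_inj; apply: tswap_id; rewrite aA bA.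
all: by rewrite (negPf AB) andbF.
Qed.

(** By [token_move_uniq], at most one ordered pair contributes. *)
Lemma sum_token_move A B :
  (\sum_p token_move G A B p)%N = token_adj G A B.
Proof.
rewrite /token_adj; case: existsP => [[p mp]|nm].
  rewrite (bigD1 p) //= mp big1 // => q qp; apply/eqP; rewrite eqb0.
  by apply: contra qp => mq; rewrite (token_move_uniq mp mq).
by rewrite big1 // => p _; apply/eqP; rewrite eqb0; apply/negP=> mp; apply: nm; exists p.
Qed.

(* Each token move is counted by its edge in both orientations. *)
Lemma sum_kswap A B : A != B ->
  (\sum_(p | sg_adj G p.1 p.2) (kswap p A == B))%N = (token_adj G A B).*2.
Proof.
move=> AB; rewrite big_mkcond /=.
pose sw (p : V * V) := (p.2, p.1).
have swK : involutive sw by case.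
transitivity (\sum_p (token_move G A B p + token_move G A B (sw p)))%N.
  by apply: eq_bigr => -[a b] _; rewrite -(kswap_move _ _ AB); case: (sg_adj _ _ _).
rewrite big_split /= sum_token_move -addnn; congr (_ + _)%N.
by rewrite -sum_token_move [RHS](reindex_inj (inv_inj swK)).
Qed.

(** Sorting the oriented edges that move [A] by the image [B] reduces this to [sum_kswap]: each
    neighbour is reached twice. *)
Lemma degree_kswap A :
  (\sum_(p | sg_adj G p.1 p.2) (kswap p A != A))%N =
  (degree (token_graph G k) A).*2.
Proof.
transitivity (\sum_(B | A != B) \sum_(p | sg_adj G p.1 p.2) (kswap p A == B))%N.
  rewrite exchange_big /=; apply: eq_bigr => p _.
  have [pA|pA] := eqVneq (kswap p A) A.
    by rewrite big1 // => B; rewrite pA => /negPf->.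
  rewrite (bigD1 (kswap p A)) /=; last by rewrite eq_sym.
  by rewrite eqxx big1 // => B /andP[_]; rewrite eq_sym => /negPf->.
rewrite (eq_bigr (fun B => (token_adj G A B).*2)); last exact: sum_kswap.
rewrite /degree -sum1_card -[RHS]muln2 big_distrl big_mkcond [RHS]big_mkcond /=.
apply: eq_bigr => B _; rewrite inE /= mul1n.
by case: eqP => [<-|_]; rewrite ?token_adj_irr //=; case: token_adj.
Qed.

End TokenLaplacian.

(** * Switched token Laplacians and the intertwining matrix *)

Section SwitchedLaplacian.

Variables (V : finType) (G : sgraph V) (s : V -> int).
Hypothesis s_pm1 : forall u, s u = 1 \/ s u = -1.
Hypothesis sign_s : forall u v, sg_adj G u v -> sg_sign G u v = s u * s v.

Definition set_sign (A : {set V}) : int := \prod_(x in A) s x.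

Lemma set_sign_pm1 A : set_sign A = 1 \/ set_sign A = -1.
Proof.
apply: (big_ind (fun e : int => e = 1 \/ e = -1)) => //; first by left.
by move=> x y [] -> [] ->; [left|right|right|left].
Qed.

Lemma set_sign_sqr A : set_sign A * set_sign A = 1.
Proof. by case: (set_sign_pm1 A) => ->. Qed.

(** The common part of [A] and [B] contributes a square, equal to 1; what remains are the two ends
    of the moved edge. *)
Lemma token_sign_switch k (A B : ksubset V k) : token_adj G A B ->
  token_sign G A B = set_sign (val A) * set_sign (val B).
Proof.
case/existsP=> p mp; rewrite (token_signE mp).
have [AB BA] := token_moveD mp; case/and4P: mp => _ _ _ /sign_s->.
rewrite /set_sign (big_setID (val B)) /= AB big_set1.
rewrite [X in _ = _ * X](big_setID (val A)) /= BA big_set1 setIC.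
by rewrite mulrACA -/(set_sign _) set_sign_sqr mul1r.
Qed.

(** The factor 2 arises because the sum runs over ordered pairs. Off the diagonal the count is
    [sum_kswap]; on it, [degree_kswap], with the switching signs squaring to 1. *)
Lemma laplacian_kswap (R : pzRingType) k (i j : 'I_#|{: ksubset V k}|) :
  let A := enum_val i in let B := enum_val j in
  laplacian_mx R (token_graph G k) i j *+ 2 =
  (set_sign (val A) * set_sign (val B))%:~R *
  \sum_(p | sg_adj G p.1 p.2) ((A == B)%:R - (kswap p A == B)%:R).
Proof.
move=> A B; rewrite !mxE -/A -/B (inj_eq enum_val_inj) /=.
have [ij|ij] := eqVneq i j.
  have -> : B = A by rewrite /B -ij.
  rewrite token_adj_irr subr0 set_sign_sqr mul1r mulr1n -mulrnA muln2.
  rewrite -degree_kswap natr_sum; apply: eq_bigr => p _.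
  by case: eqP; rewrite ?subrr ?subr0.
have AB : A != B by rewrite (inj_eq enum_val_inj).
under eq_bigr do rewrite sub0r.
rewrite sumrN -natr_sum sum_kswap // mulr0n sub0r mulrN mulNrn; congr (- _).
case: ifP => [/token_sign_switch->|_]; last by rewrite mulr0 mul0rn.
by rewrite mulr_natr.
Qed.

Lemma sum_enum_val (R : nmodType) (T : finType) (F : T -> R) :
  \sum_(i < #|T|) F (enum_val i) = \sum_x F x.
Proof. by rewrite [RHS]big_enum_val. Qed.

Definition switched_inclusion_mx (R : pzRingType) k2 k1 :
    'M[R]_(#|{: ksubset V k2}|, #|{: ksubset V k1}|) :=
  \matrix_(i, j) ((set_sign (val (enum_val i)) *
                   set_sign (val (enum_val j)))%:~R *
                  (val (enum_val j) \subset val (enum_val i))%:R).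

Lemma switched_inclusion_signed_binomial (R : pzRingType) k2 k1 :
  signed_binomial (switched_inclusion_mx R k2 k1).
Proof.
move=> i j; rewrite mxE; case: (_ \subset _); last by rewrite mulr0.
case: (set_sign_pm1 (val (enum_val i))) => ->;
  case: (set_sign_pm1 (val (enum_val j))) => ->; rewrite !mulr1.
all: by [left | right].
Qed.

Lemma switched_inclusion_laplacian (R : numDomainType) k2 k1 :
  switched_inclusion_mx R k2 k1 *m laplacian_mx R (token_graph G k1) =
  laplacian_mx R (token_graph G k2) *m switched_inclusion_mx R k2 k1.
Proof.
(* Doubling both sides, which is injective in a [numDomainType], makes [laplacian_kswap]
   applicable. *)
apply/matrixP=> i j; apply: (@pmulrnI _ 2) => //; rewrite !mxE -!sumrMnl.
set A := enum_val i; set X := enum_val j.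
pose S (C : {set V}) : R := (set_sign C)%:~R.
have SS C : S C * S C = 1 by rewrite -intrM set_sign_sqr.
(* The sign of the intermediate subset occurs in both factors and cancels. *)
have mulSS (C : {set V}) a x t u : a * S C * t * (S C * x * u) = a * x * (t * u).
  by rewrite -[RHS]mul1r -(SS C); ring.
(* Both products are brought to this common value, in which the transposition acts on the column
   index [X]. *)
transitivity (S (val A) * S (val X) * \sum_(p | sg_adj G p.1 p.2)
    ((val X \subset val A)%:R - (val (kswap p X) \subset val A)%:R)).
  transitivity (\sum_(Y : ksubset V k1) S (val A) * S (val X) *
      \sum_(p | sg_adj G p.1 p.2)
        (val Y \subset val A)%:R * ((Y == X)%:R - (kswap p Y == X)%:R)).
    rewrite -[RHS]sum_enum_val; apply: eq_bigr => l _.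
    by rewrite -mulrnAr laplacian_kswap mxE !intrM mulSS -mulr_sumr.
  rewrite -mulr_sumr exchange_big; congr (_ * _); apply: eq_bigr => p _.
  under eq_bigr do rewrite mulrBr; rewrite sumrB; congr (_ - _).
    rewrite (bigD1 X) //= eqxx mulr1 big1 ?addr0 // => Y /negPf->.
    by rewrite mulr0.
  (* As [kswap p] is an involution, only [Y = kswap p X] is sent to [X]. *)
  rewrite (bigD1 (kswap p X)) //= kswapK eqxx mulr1 big1 ?addr0 // => Y.
  by rewrite (inv_eq (@kswapK _ _ p)) => /negPf->; rewrite mulr0.
transitivity (\sum_(Y : ksubset V k2) S (val A) * S (val X) *
    \sum_(p | sg_adj G p.1 p.2)
      ((A == Y)%:R - (kswap p A == Y)%:R) * (val X \subset val Y)%:R).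
  rewrite -mulr_sumr exchange_big; congr (_ * _); apply: eq_bigr => p _.
  under [RHS]eq_bigr do rewrite mulrBl; rewrite sumrB; congr (_ - _).
    rewrite (bigD1 A) //= eqxx mul1r big1 ?addr0 // => Y.
    by rewrite eq_sym => /negPf->; rewrite mul0r.
  (* Here the transposition acts on [A]; [tswap_subset] carries it over to [X]. *)
  rewrite (bigD1 (kswap p A)) //= eqxx mul1r -tswap_subset big1 ?addr0 // => Y.
  by rewrite eq_sym => /negPf->; rewrite mul0r.
rewrite -[LHS]sum_enum_val; apply: eq_bigr => l _.
by rewrite -mulrnAl laplacian_kswap mxE !intrM mulSS -mulr_suml.
Qed.

End SwitchedLaplacian.

Theorem theorem6p3 (R : realFieldType) (n : nat) (G : sgraph 'I_n)
    (hG : balanced G) (k1 k2 : nat)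
    (hk1 : (1 <= k1)%N) (hk12 : (k1 < k2)%N) (hk2 : (k2 < n)%N) :
  exists B : 'M[R]_(#|{: ksubset 'I_n k2}|, #|{: ksubset 'I_n k1}|),
    signed_binomial B /\
    B *m laplacian_mx R (token_graph G k1)
      = laplacian_mx R (token_graph G k2) *m B.
Proof.
have [s [s_pm1 sign_s]] := balanced_switching hG.
exists (switched_inclusion_mx s R k2 k1); split.
  exact: switched_inclusion_signed_binomial.
exact: switched_inclusion_laplacian.
Qed.
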